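(* Let $G$ be a connected graph belonging to $\mathbf{W}_2$, with $n=n(G)$ and $\alpha=\alpha(G)$. Suppose that $n\ge3\alpha$. If $$k^2-(n-2\alpha)k+2\alpha+2\ge0$$ for every integer $k$ with $1\le k\le\alpha-1$, then the independence polynomial $I(G;x)$ is log-concave.
   Context: All graphs are finite, undirected and simple. $V(G)$ is the vertex set, $n(G)=|V(G)|$, and $\alpha(G)$ is the maximum cardinality of an independent set of $G$. A maximum independent set is an independent set of cardinality $\alpha(G)$. The empty set is an independent set. For an integer $p\ge1$, a graph $G$ belongs to $\mathbf{W}_p$ if $n(G)\ge p$ and, for every $p$ pairwise disjoint independent sets $A_1,\ldots,A_p$ of $G$ (possibly empty), there exist $p$ pairwise disjoint maximum independent sets $S_1,\ldots,S_p$ of $G$ such that $A_i\subseteq S_i$ for every $i$. The independence polynomial of $G$ is $I(G;x)=\sum_{k=0}^{\alpha(G)}s_kx^k$, where $s_k$ is the number of independent sets of $G$ of cardinality $k$. It is log-concave if $s_k^2\ge s_{k-1}s_{k+1}$ for all $1\le k\le\alpha(G)-1$. *)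

(* Defs.v *)
From HB Require Import structures.
From mathcomp Require Import all_boot all_order all_algebra.
Set Implicit Arguments.
Unset Strict Implicit.
Unset Printing Implicit Defensive.
Import Order.TTheory GRing.Theory Num.Theory.
Local Open Scope ring_scope.

Definition independent (T : finType) (e : rel T) (A : {set T}) : bool :=
  [forall x in A, forall y in A, ~~ e x y].

Definition indep_number (T : finType) (e : rel T) : nat :=
  (\max_(A : {set T} | independent e A) #|A|)%N.

Definition max_independent (T : finType) (e : rel T) (A : {set T}) : bool :=
  independent e A && (#|A| == indep_number e).

Definition pairwise_disjoint (T : finType) (p : nat) (A : 'I_p -> {set T}) :
    Prop :=
  forall i j : 'I_p, i != j -> [disjoint A i & A j].

(* Meant for p >= 1. *)
Definition in_W (p : nat) (T : finType) (e : rel T) : Prop :=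
  (p <= #|T|)%N /\
  forall A : 'I_p -> {set T},
    (forall i, independent e (A i)) -> pairwise_disjoint A ->
    exists S : 'I_p -> {set T},
      [/\ forall i, max_independent e (S i),
          pairwise_disjoint S
        & forall i, A i \subset S i].

Definition num_indep (T : finType) (e : rel T) (k : nat) : nat :=
  #|[set A : {set T} | independent e A & #|A| == k]|.

Definition indep_poly (T : finType) (e : rel T) : {poly int} :=
  \poly_(k < (indep_number e).+1) (num_indep e k)%:Z.

Definition indep_poly_log_concave (T : finType) (e : rel T) : Prop :=
  forall k : nat, (1 <= k <= indep_number e - 1)%N ->
    (indep_poly e)`_(k - 1) * (indep_poly e)`_(k + 1)
      <= (indep_poly e)`_k ^+ 2.

(* The empty graph also satisfies this; it is excluded by [in_W p] for p >= 1. *)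
Definition connected_graph (T : finType) (e : rel T) : Prop :=
  forall x y : T, connect e x y.

(* Main.v *)
Require Import Defs.
From HB Require Import structures.
From mathcomp Require Import all_boot all_order all_algebra.
From mathcomp Require Import zify.
Set Implicit Arguments.
Unset Strict Implicit.
Unset Printing Implicit Defensive.
Import Order.TTheory GRing.Theory Num.Theory.

(** Log-concavity follows by multiplying two bounds on consecutive counts.
    Counting pairs of an independent k-set [A] and a vertex extending it gives
    [(k+1) s_(k+1)] as the sum of [n - #|N[A]|] over all such [A]. Deleting
    [N[A]] from a graph of W_2 leaves a graph of W_2 with independence number
    [alpha - k], which has at least [2 (alpha - k)] vertices; hence
    [2 (alpha - k) s_k <= (k+1) s_(k+1)]. If moreover the graph is connected
    and [k < alpha], then [#|N(A)| >= 2 #|A|], so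
    [(k+1) s_(k+1) <= (n - 3k) s_k]. The quadratic condition is exactly what
    makes the second bound at [k] times the first one at [k-1] say that
    [s_(k-1) s_(k+1) <= s_k ^ 2].

    The substance is the expansion [#|N(A)| >= 2 #|A|] for a non-maximum
    independent set [A] of a connected graph of W_2. It is proved by induction
    on the vertex set, together with a deletion bound: if deleting a set [K]
    that meets every component of a subgraph [U] leaves a graph of W_2 again,
    then [#|U| >= 2 alpha(U) + alpha(U - K)] (Lemma [deletion_bound_W2_on]).
    For connected [U] of W_2, expansion gives [#|U| >= 3 alpha(U) - 1], so the
    deletion bound only says that in the extremal case the deletion of [K]
    lowers the independence number.

    Both halves of the induction rest on
    Lemma [expansion_from_proper_subsets]. There [A] is an independent set all
    of whose proper subsets expand, and [D] is [N[A]] without a nonempty set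
    [Z] of neighbours of [A], with [D] in W_2 and [alpha(D) = #|A|]. Take an
    independent set [J] that meets [Z] and is maximal outside [D], and split
    [D] into the components [D1] touched by [Y = J :&: Z] and the rest [D0].
    On [D0] one uses that the proper subset [A :&: D0] of [A] expands without
    help from [Y]. On [D1] one uses the deletion bound, while well-coveredness
    shows that [J] lowers the independence number of [D1] by at most [#|Y|].
    The two estimates add up to the expansion of [A]. *)

(** * Neighbourhoods and independence numbers of induced subgraphs *)

Lemma cards_disjU (T : finType) (A B : {set T}) :
  [disjoint A & B] -> #|A :|: B| = #|A| + #|B|.
Proof. by move=> dAB; apply/eqP; rewrite (leq_card_setU A B). Qed.

Section Graph.
Variables (T : finType) (e : rel T).
Hypotheses (e_sym : symmetric e) (e_irr : irreflexive e).
Implicit Types (A B C D I J K L M Q R U V X Y Z : {set T}) (r u v w x y z : T).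

Lemma independentP A :
  reflect {in A &, forall x y, ~~ e x y} (independent e A).
Proof.
apply: (iffP forall_inP) => [h x y xA yA | h x xA].
  exact: (forall_inP (h x xA)).
by apply/forall_inP => y; apply: h.
Qed.

Lemma independentS A B : A \subset B -> independent e B -> independent e A.
Proof.
move=> /subsetP AB /independentP iB; apply/independentP => x y xA yA.
by apply: iB; apply: AB.
Qed.

Lemma independent0 : independent e set0.
Proof. by apply/independentP => x y; rewrite inE. Qed.

Lemma independent1 v : independent e [set v].
Proof. by apply/independentP => x y /set1P-> /set1P->; rewrite e_irr. Qed.

Definition nbr A : {set T} := \bigcup_(a in A) [set u | e a u].
Definition cln A : {set T} := A :|: nbr A.

Lemma nbrP A u : reflect (exists2 a, a \in A & e a u) (u \in nbr A).
Proof.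
by apply: (iffP bigcupP) => -[a aA]; rewrite ?inE => h; exists a; rewrite ?inE.
Qed.

Lemma mem_cln A u : (u \in cln A) = (u \in A) || (u \in nbr A).
Proof. by rewrite in_setU. Qed.

Lemma nbrS A B : A \subset B -> nbr A \subset nbr B.
Proof.
move=> /subsetP AB; apply/subsetP => u /nbrP[a aA au].
by apply/nbrP; exists a => //; apply: AB.
Qed.

Lemma nbrU A B : nbr (A :|: B) = nbr A :|: nbr B.
Proof. by rewrite /nbr bigcup_setU. Qed.

Lemma clnU A B : cln (A :|: B) = cln A :|: cln B.
Proof. by rewrite /cln nbrU setUACA. Qed.

Lemma disjoint_nbrC A B : [disjoint nbr A & B] = [disjoint A & nbr B].
Proof.
suff h C D : [disjoint nbr C & D] -> [disjoint C & nbr D].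
  by apply/idP/idP => [|h1]; [exact: h | rewrite disjoint_sym h // disjoint_sym].
rewrite !disjoint_subset => /subsetP h; apply/subsetP => c cC; rewrite inE.
apply/negP => /nbrP[d dD dc]; move: (h d); rewrite inE dD.
by move=> /(_ _)/negP; apply; last by []; apply/nbrP; exists c; rewrite // e_sym.
Qed.

Lemma independent_disjoint A : independent e A -> [disjoint A & nbr A].
Proof.
move=> /independentP iA; rewrite disjoint_subset; apply/subsetP => x xA.
by rewrite inE; apply/negP => /nbrP[a aA]; apply/negP/iA.
Qed.

Lemma independentU A B : independent e A -> independent e B ->
  [disjoint nbr A & B] -> independent e (A :|: B).
Proof.
move=> /independentP iA /independentP iB; rewrite disjoint_subset => /subsetP d.
have nAB x y : x \in A -> y \in B -> ~~ e x y.
  move=> xA yB; apply/negP => xy.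
  have /d : y \in nbr A by apply/nbrP; exists x.
  by rewrite inE yB.
apply/independentP => x y /setUP[]xX /setUP[]yX; [exact: iA | exact: nAB | | exact: iB].
by rewrite e_sym; apply: nAB.
Qed.

Definition alpha U : nat := \max_(A : {set T} | independent e A && (A \subset U)) #|A|.

Lemma leq_alpha A U : independent e A -> A \subset U -> #|A| <= alpha U.
Proof. by move=> iA AU; rewrite /alpha (bigD1 A) ?iA ?leq_maxl. Qed.

Lemma alpha_witness U : exists A, [/\ independent e A, A \subset U & #|A| = alpha U].
Proof.
have h : 0 < #|[pred A : {set T} | independent e A && (A \subset U)]|.
  by apply/card_gt0P; exists set0; rewrite inE independent0 sub0set.
have [A] := eq_bigmax_cond (fun A : {set T} => #|A|) h.
by rewrite inE => /andP[iA AU] E; exists A; split=> //; rewrite -E.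
Qed.

Lemma alphaS U V : U \subset V -> alpha U <= alpha V.
Proof.
move=> UV; have [A [iA AU <-]] := alpha_witness U.
by apply: leq_alpha => //; apply: subset_trans UV.
Qed.

Lemma alpha0 : alpha set0 = 0.
Proof.
by have [A [_ A0 <-]] := alpha_witness set0; move: A0; rewrite subset0 => /eqP->; rewrite cards0.
Qed.

Lemma alphaT : alpha setT = indep_number e.
Proof. by apply: eq_bigl => A; rewrite subsetT andbT. Qed.

Lemma leq_alphaU U V : alpha (U :|: V) <= alpha U + alpha V.
Proof.
have [A [iA AU <-]] := alpha_witness (U :|: V).
have -> : A = (A :&: U) :|: (A :&: V) by rewrite -setIUr; apply/esym/setIidPl.
apply: leq_trans (leq_card_setU _ _) _.
by apply: leq_add; apply: leq_alpha; rewrite ?subsetIr //; apply: independentS iA; rewrite subsetIl.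
Qed.

Lemma exists_maximal X U : independent e X -> X \subset U ->
  exists M, [/\ independent e M, X \subset M, M \subset U & U \subset cln M].
Proof.
move=> iX XU; pose P M := independent e M && (M \subset U).
have [|M] := @maxset_exists _ P X; first by rewrite /P iX.
move=> /maxsetP[/andP[iM MU] mM] XM; exists M; split=> //.
apply/subsetP => u uU; rewrite mem_cln; apply/orP.
case: (boolP (u \in nbr M)) => uN; first by right.
left; rewrite -(mM (M :|: [set u])) ?subsetUl //; first by rewrite !inE eqxx orbT.
rewrite /P subUset MU sub1set uU !andbT independentU ?independent1 //.
by rewrite disjoint_sym disjoints1.
Qed.

Lemma alpha_maximal A U : independent e A -> A \subset U -> #|A| = alpha U ->
  U \subset cln A.
Proof.
move=> iA AU cA; have [M [iM AM MU UM]] := exists_maximal iA AU.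
suff -> : A = M by [].
by apply/eqP; rewrite eqEcard AM cA leq_alpha.
Qed.

(** * Induced subgraphs in the class W_2 *)

(** The class W_2 for the subgraph induced on [U], in the form used below:
    well-coveredness, and no isolated vertex after deleting a closed
    neighbourhood. Unlike membership in W_2, this admits the empty subgraph, so
    that it passes to localizations [U :\: cln X] and to unions of components
    without exception. *)
Definition W2_on U : Prop :=
  (forall X, independent e X -> X \subset U -> U \subset cln X -> #|X| = alpha U)
  /\ (forall X v, independent e X -> X \subset U -> v \in U :\: cln X ->
        exists2 w, w \in U :\: cln X & e v w).

Lemma disjoint_localize X A U : A \subset U :\: cln X -> [disjoint nbr X & A].
Proof.
move=> /subsetP AU; rewrite disjoint_sym disjoint_subset; apply/subsetP => a /AU.
by rewrite inE [a \in cln X]mem_cln inE; case: (a \in nbr X); rewrite ?orbT.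
Qed.

(** Adding [X] turns the maximal independent sets of [U :\: cln X] into maximal
    independent sets of [U]. *)
Lemma W2_on_localize U X : W2_on U -> independent e X -> X \subset U ->
  W2_on (U :\: cln X) /\ alpha U = #|X| + alpha (U :\: cln X).
Proof.
move=> [gc gi] iX XU.
have ext A : independent e A -> A \subset U :\: cln X ->
  [/\ independent e (X :|: A), X :|: A \subset U & #|X :|: A| = #|X| + #|A|].
  move=> iA AU; split.
  - by apply: independentU => //; apply: disjoint_localize AU.
  - by rewrite subUset XU (subset_trans AU) ?subsetDl.
  - rewrite cardsU (_ : X :&: A = set0) ?cards0 ?subn0 //.
    apply/setP => x; rewrite !inE; apply/negP => /andP[xX /(subsetP AU)].
    by rewrite inE mem_cln xX.
have cov A : U :\: cln X \subset cln A -> U \subset cln (X :|: A).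
  move=> UA; apply/subsetP => u uU; rewrite clnU inE.
  by case: (boolP (u \in cln X)) => //= uX; apply: (subsetP UA); rewrite inE uX.
have card A : independent e A -> A \subset U :\: cln X -> U :\: cln X \subset cln A ->
  #|X| + #|A| = alpha U.
  move=> iA AU UA; have [iXA XAU <-] := ext A iA AU.
  by apply: gc => //; apply: cov.
have [M [iM MU cM]] := alpha_witness (U :\: cln X).
have E : alpha U = #|X| + alpha (U :\: cln X).
  by rewrite -cM card //; apply: alpha_maximal.
split=> //; split.
- by move=> A iA AU UA; apply: (@addnI #|X|); rewrite -E; apply: card.
move=> A v iA AU vU; have [iXA XAU _] := ext A iA AU.
by have := gi _ v iXA XAU; rewrite clnU -setDDl => /(_ vU).
Qed.

(** The set [K] is a union of connected components of [U]. Working with such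
    unions avoids enumerating components. *)
Definition splits U K : bool := (K \subset U) && [disjoint nbr K & U :\: K].
Definition connected_on U : bool := [forall K : {set T}, splits U K ==> (K == set0) || (K == U)].

Lemma splitsC U K : splits U K -> splits U (U :\: K).
Proof.
move=> /andP[KU d]; rewrite /splits subsetDl setDDr setDv set0U.
by rewrite disjoint_nbrC disjoint_sym (setIidPr KU).
Qed.

Lemma alpha_splits U K : splits U K -> alpha U = alpha K + alpha (U :\: K).
Proof.
move=> /andP[KU d]; apply/eqP; rewrite eqn_leq; apply/andP; split.
  by rewrite -{1}(setID U K) (setIidPr KU) leq_alphaU.
have [A [iA AK <-]] := alpha_witness K.
have [B [iB BK <-]] := alpha_witness (U :\: K).
have dAB : [disjoint A & B].
  apply: disjointWl AK _; apply: disjointWr BK _.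
  by rewrite disjoint_sym disjoints_subset subsetDr.
rewrite -cards_disjU // leq_alpha //.
  by apply: independentU => //; apply: disjointWr BK _; apply: disjointWl d; apply: nbrS.
by rewrite subUset (subset_trans AK) // (subset_trans BK) ?subsetDl.
Qed.

(** [K] is the localization of [U] at a maximal independent set of the other
    components, so nothing about [K] itself has to be proved. *)
Lemma W2_on_splits U K : W2_on U -> splits U K -> W2_on K.
Proof.
move=> gU sK; have /andP[KU _] := sK; have /andP[LU d] := splitsC sK.
have [M [iM _ ML LM]] := exists_maximal independent0 (sub0set (U :\: K)).
have [|+ _] := W2_on_localize gU iM; first exact: subset_trans ML _.
suff -> : U :\: cln M = K by [].
apply/setP => x; rewrite inE; apply/andP/idP => [[xM xU]|xK].
  by apply: contraR xM => xK; apply: (subsetP LM); rewrite inE xK.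
split; last exact: (subsetP KU).
rewrite mem_cln; apply/norP; split; apply/negP.
  by move=> /(subsetP ML); rewrite inE xK.
by move=> /(subsetP (nbrS ML)) /(disjointFr d); rewrite !inE xK (subsetP KU).
Qed.

Lemma splitsP U K : reflect
  (K \subset U /\ forall x y, x \in K -> y \in U -> e x y -> y \in K) (splits U K).
Proof.
apply: (iffP andP) => -[KU h]; split=> //.
  move=> x y xK yU xy; apply: contraT => yK.
  have /(disjointFr h) : y \in nbr K by apply/nbrP; exists x.
  by rewrite inE yK yU.
rewrite disjoint_subset; apply/subsetP => y /nbrP[x xK xy].
by rewrite !inE; case: (boolP (y \in U)) => [/(h _ _ xK)->|]; rewrite ?andbF.
Qed.

Lemma splitsD U K N : splits U K -> splits (U :\: N) (K :\: N).
Proof.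
move=> /splitsP[KU h]; apply/splitsP; split; first exact: setSD.
by move=> x y; rewrite !inE => /andP[_ xK] /andP[-> yU] xy; apply: h xy.
Qed.

(** Stated over unions of components: this says that [K] meets every connected
    component of [U]. *)
Definition meets_parts U K : Prop :=
  forall Q, splits U Q -> Q != set0 -> ~~ [disjoint Q & K].

(** Connected [U] of W_2 turn out to have at least [3 alpha(U) - 1] vertices, so
    for them the bound says that deleting [K] lowers the independence number in
    the case of equality. Summed over components, it bounds the number of
    components with [3 alpha - 1] vertices by the total drop of the independence
    number, which is how it gets used. *)
Definition deletion_bound U : Prop :=
  forall K, K \subset U -> W2_on (U :\: K) -> meets_parts U K ->
    2 * alpha U + alpha (U :\: K) <= #|U|.

(** * Expansion of independent sets *)

(** The common step of the induction. The components of [D] are handled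
    according to whether the part [Y] of [Z] touches them: [D0] collects the
    untouched ones, whose share of [A] has all its neighbours in [D0] or in
    [Z :\: Y]; the touched ones, [D1], obey the deletion bound. *)
Lemma expansion_from_proper_subsets U A Z :
  (forall V, #|V| < #|U| -> W2_on V -> deletion_bound V) ->
  W2_on U -> independent e A -> A \subset U ->
  (forall B, B \proper A -> 2 * #|B| <= #|nbr B :&: U|) ->
  Z \subset nbr A :&: U -> Z != set0 ->
  W2_on (cln A :&: U :\: Z) -> alpha (cln A :&: U :\: Z) = #|A| ->
  2 * #|A| <= #|nbr A :&: U|.
Proof.
move=> IH gU iA AU minA ZN /set0Pn[z zZ]; set D := _ :\: Z => gD aD.
have dAN := independent_disjoint iA.
have AD : A \subset D.
  apply/subsetP => a aA; rewrite !inE aA (subsetP AU) ?andbT //=.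
  by apply: contraTN aA => /(subsetP ZN)/setIP[/(disjointFl dAN)->].
have DU : D \subset U by rewrite (subset_trans (subsetDl _ _)) ?subsetIr.
have dDZ : [disjoint D & Z] by rewrite disjoints_subset subsetDr.
have cD : #|D| + #|Z| = #|A| + #|nbr A :&: U|.
  rewrite -!cards_disjU //; last by apply: disjointWr dAN; rewrite subsetIl.
  apply: eq_card => x; rewrite !inE.
  case: (boolP (x \in Z)) => [/(subsetP ZN)/setIP[-> ->]|_]; rewrite ?orbT // orbF.
  by case: (boolP (x \in A)) => //= /(subsetP AU)->.
pose R := U :\: cln A.
(* Maximality in [Z :|: R], the complement of [D] in [U], makes what remains
   after deleting [cln J] equal to [D :\: nbr J]. *)
have [J [iJ zJ JZR ZRJ]] : exists J, [/\ independent e J, [set z] \subset J,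
    J \subset Z :|: R & Z :|: R \subset cln J].
  by apply: exists_maximal; rewrite ?independent1 // sub1set inE zZ.
have ZU : Z \subset U by rewrite (subset_trans ZN) ?subsetIr.
have JU : J \subset U by rewrite (subset_trans JZR) // subUset ZU subsetDl.
have GJ : U :\: cln J = D :\: nbr J.
  apply/setP => x; rewrite inE mem_cln [in RHS]inE negb_or.
  case: (boolP (x \in nbr J)) => xN; rewrite ?andbF //= ?andbT.
  have [xZR|xZR] := boolP (x \in Z :|: R).
    have := subsetP ZRJ _ xZR; rewrite mem_cln (negPf xN) orbF => -> /=.
    by move: xZR; rewrite !inE; case: (x \in Z) => //= /andP[/negPf-> _].
  rewrite (contra (subsetP JZR x) xZR) /=.
  by move: xZR; rewrite !inE; case: (x \in Z) => //=; case: (x \in U); rewrite ?andbF ?andbT ?negbK.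
have [gJ aU] := W2_on_localize gU iJ JU; rewrite {}GJ in gJ aU.
pose Y := J :&: Z.
have cJ : #|J| = #|Y| + #|J :&: R|.
  rewrite -cards_disjU; first by rewrite -setIUr (setIidPl JZR).
  apply: disjointWl (subsetIr _ _) _; apply: disjointWr (subsetIr _ _) _.
  rewrite disjoints_subset; apply: subset_trans ZN _; apply/subsetP => x.
  by rewrite !inE => /andP[->]; rewrite orbT.
(* No edge joins [A] to [R]. Compared with [aU], this leaves at most [#|Y|] for
   the drop of the independence number from [D] to [D :\: nbr J]. *)
have aR : #|A| + #|J :&: R| <= alpha U.
  have dAJ : [disjoint cln A & J :&: R].
    by apply: disjointWr (subsetIr _ _) _; rewrite disjoint_sym disjoints_subset subsetDr.
  rewrite -cards_disjU; last by apply: disjointWl dAJ; apply: subsetUl.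
  apply: leq_alpha; last by rewrite subUset AU (subset_trans (subsetIl _ _)).
  apply: independentU => //; first by apply: independentS iJ; apply: subsetIl.
  by apply: disjointWl dAJ; apply: subsetUr.
(* [D0] is the union of the components of [D] without a neighbour in [Y]. *)
have [|D0] := @maxset_exists _ (fun Q => splits D Q && [disjoint nbr Y & Q]) set0.
  by apply/andP; split; [apply/splitsP; split=> [|x y]; rewrite ?sub0set ?inE | rewrite disjoint_sym disjoints_subset sub0set].
move=> /maxsetP[/andP[sD0 dD0] mD0] _.
have sD1 := splitsC sD0; set D1 := D :\: D0 in sD1.
have [D0D hD0] := splitsP _ _ sD0; have [D1D hD1] := splitsP _ _ sD1.
have eD0 : D :\: D1 = D0 by rewrite /D1 setDDr setDv set0U (setIidPr D0D).
have sDJ := splitsD (nbr J) sD1.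
(* Maximality of [D0] says that [nbr J], which contains [nbr Y], meets every
   component of [D1]. *)
have bound : 2 * alpha D1 + alpha (D1 :\: nbr J) <= #|D1|.
  have eK : D1 :\: (nbr J :&: D1) = D1 :\: nbr J by rewrite setDIr setDv setU0.
  rewrite -eK; apply: IH; first last.
  - move=> Q /splitsP[QD1 hQ]; apply: contraNN => dQ; rewrite -subset0.
    have eQ : D0 :|: Q = D0.
      apply: mD0; last exact: subsetUl.
      apply/andP; split.
        apply/splitsP; split; first by rewrite subUset D0D (subset_trans QD1).
        move=> x y /setUP[xD0|xQ] yD xy; rewrite inE; first by rewrite (hD0 x).
        have [//|yD0] := boolP (y \in D0).
        by rewrite (hQ x) // inE yD0.
      rewrite disjoint_sym disjoint_subset; apply/subsetP => x /setUP[xD0|xQ]; rewrite inE.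
        by rewrite (disjointFl dD0 xD0).
      apply/negP => xY; have /negP[] := negbT (disjointFr dQ xQ).
      by rewrite inE (subsetP QD1) // andbT (subsetP (nbrS (subsetIl _ _ : Y \subset J))).
    apply/subsetP => x xQ; have := subsetP QD1 x xQ; rewrite inE => /andP[/negP[]].
    by rewrite -eQ inE xQ orbT.
  - by rewrite eK; apply: W2_on_splits gJ sDJ.
  - exact: subsetIr.
  - exact: W2_on_splits gD sD1.
  - apply: proper_card; apply/properP; split; first exact: subset_trans DU.
    by exists z; [apply: (subsetP ZU) | rewrite !inE zZ andbF].
have aDJ : alpha (D :\: nbr J) <= alpha D0 + alpha (D1 :\: nbr J).
  rewrite (alpha_splits sDJ) addnC leq_add2r alphaS // -eD0.
  suff h (P Q N : {set T}) : P :\: N :\: (Q :\: N) \subset P :\: Q by apply: h.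
  by apply/subsetP => x; rewrite !inE; case: (x \in N); rewrite ?andbF.
have aDD := alpha_splits sD1; rewrite eD0 in aDD.
pose A0 := A :&: D0; pose A1 := A :&: D1.
have cA : #|A| = #|A0| + #|A1|.
  by rewrite -(cardsID D0 A) /A1 /D1 setIDA (setIidPl AD).
have a0 : #|A0| <= alpha D0.
  by apply: leq_alpha; [apply: independentS iA; apply: subsetIl | apply: subsetIr].
have a1 : #|A1| <= alpha D1.
  by apply: leq_alpha; [apply: independentS iA; apply: subsetIl | apply: subsetIr].
have zY : z \in Y by rewrite inE zZ -sub1set zJ.
(* The vertex [z] has a neighbour in [A], which cannot lie in [D0]. *)
have pA0 : A0 \proper A.
  have /(subsetP ZN)/setIP[/nbrP[a aA az] _] := zZ.
  apply/properP; split; first exact: subsetIl.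
  exists a => //; rewrite inE aA /= (disjointFr dD0) //.
  by apply/nbrP; exists z; rewrite // e_sym.
have nA0 : #|nbr A0 :&: U| + #|A0| + #|Y| <= #|D0| + #|Z|.
  have sub : nbr A0 :&: U \subset (D0 :\: A0) :|: (Z :\: Y).
    apply/subsetP => x /setIP[/nbrP[a /setIP[aA aD0] ax] xU].
    have xN : x \in nbr A by apply/nbrP; exists a.
    have xA : x \notin A by rewrite (disjointFl dAN).
    rewrite !inE (negPf xA) /=; case: (boolP (x \in Z)) => xZ /=.
      rewrite andbT; case: (boolP (x \in J)) => xJ; rewrite ?orbT //=.
      suff : a \in nbr Y by rewrite (disjointFl dD0 aD0).
      by apply/nbrP; exists x; rewrite ?inE ?xJ // e_sym.
    by rewrite andbF orbF (hD0 a) // !inE xZ xN orbT.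
  have := subset_leq_card sub; have [+ _] := leq_card_setU (D0 :\: A0) (Z :\: Y).
  have := cardsID A0 D0; have := cardsID Y Z.
  rewrite (setIidPr (subsetIr _ _ : A0 \subset D0)) (setIidPr (subsetIr _ _ : Y \subset Z)).
  clear; lia.
have := minA _ pA0; have := cardsID D0 D; rewrite (setIidPr D0D) -/D1.
move: cA cD cJ aR aU aDJ aDD bound aD a0 a1 nA0; clear; lia.
Qed.

(** If [A] is not maximum, connectivity provides an edge from a neighbour [x] of
    [A] to a vertex [y] outside [N[A]]. Deleting the closed neighbourhood of a
    maximal independent set [I] of that outside, with [y] in [I], leaves [N[A]]
    without the nonempty set [Z] of common neighbours of [A] and [I], and [A]
    becomes maximum there. *)
Lemma expansion_step U :
  (forall V, #|V| < #|U| -> W2_on V -> deletion_bound V) -> W2_on U -> connected_on U ->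
  forall A, independent e A -> A \subset U -> #|A| < alpha U ->
  2 * #|A| <= #|nbr A :&: U|.
Proof.
move=> IH gU cU A; have [n] := ubnP #|A|; elim: n A => // n IHn A An iA AU aA.
have [->|[a aA0]] := set_0Vmem A; first by rewrite cards0.
have dAN := independent_disjoint iA.
pose R := U :\: cln A.
have [x xC [y yR xy]] : exists2 x, x \in cln A :&: U & exists2 y, y \in R & e x y.
  have nU : cln A :&: U != U.
    apply/negP => /eqP/setIidPr UA; have [/(_ A iA AU UA) E _] := gU.
    by rewrite E ltnn in aA.
  have n0 : cln A :&: U != set0.
    by apply/set0Pn; exists a; rewrite inE mem_cln aA0 (subsetP AU).
  move/forallP: cU => /(_ (cln A :&: U)); rewrite (negPf nU) (negPf n0) implybF.
  rewrite /splits subsetIr /= => /pred0Pn[y /andP[/nbrP[x xC xy] /setDP[yU yC]]].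
  by exists x => //; exists y => //; rewrite inE yU andbT; move: yC; rewrite inE yU andbT.
have xN : x \in nbr A.
  have /setIP[+ _] := xC; rewrite mem_cln => /orP[xA|//].
  have /setDP[_] := yR; rewrite mem_cln; case/norP=> _ /negP[].
  by apply/nbrP; exists x.
have [I [iI yI IR RI]] : exists I, [/\ independent e I, [set y] \subset I,
    I \subset R & R \subset cln I].
  by apply: exists_maximal; rewrite ?independent1 // sub1set.
have IU : I \subset U := subset_trans IR (subsetDl _ _).
have dAI : [disjoint cln A & I].
  by apply: disjointWr IR _; rewrite disjoint_sym disjoints_subset subsetDr.
have dAI1 : [disjoint nbr A & I] by apply: disjointWl dAI; apply: subsetUr.
pose Z := nbr A :&: U :&: nbr I.
have eD : cln A :&: U :\: Z = U :\: cln I.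
  apply/setP => u; rewrite !in_setD !in_setI mem_cln [u \in cln I]mem_cln.
  case: (boolP (u \in U)) => uU; rewrite ?andbF ?andbT //=.
  have [uI|uI] := boolP (u \in I).
    by have := disjointFl dAI uI; rewrite mem_cln => ->; rewrite andbF.
  rewrite /=; have [uN|uN] := boolP (u \in nbr A); rewrite ?orbT ?andbT ?orbF //=.
  have [uA|uA] := boolP (u \in A).
    by apply/esym; rewrite (disjointFr _ uA) // -disjoint_nbrC.
  apply/esym/negbTE; rewrite negbK.
  have := subsetP RI u; rewrite in_setD mem_cln (negPf uA) (negPf uN) uU.
  by rewrite mem_cln (negPf uI); apply.
have [gD aD] := W2_on_localize gU iI IU.
have eA : #|A| + #|I| = alpha U.
  have [wc _] := gU; rewrite -cards_disjU; last first.
    by apply: disjointWl dAI; apply: subsetUl.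
  apply: wc; first exact: independentU.
    by rewrite subUset AU.
  apply/subsetP => u uU; rewrite clnU inE; case: (boolP (u \in cln A)) => //= uA.
  by apply: (subsetP RI); rewrite inE uA.
apply: (@expansion_from_proper_subsets U A Z) => //.
- move=> B pB; have [BA _] := andP pB; have lB := proper_card pB.
  apply: IHn; [by apply: leq_trans lB _; rewrite -ltnS | exact: independentS iA | exact: subset_trans AU |].
  exact: ltn_trans aA.
- exact: subsetIl.
- apply/set0Pn; exists x; rewrite inE inE xN /=; have /setIP[_ ->] := xC.
  by apply/nbrP; exists y; rewrite 1?e_sym // -sub1set.
- by rewrite eD.
- by rewrite eD; apply: (@addnI #|I|); rewrite -aD addnC.
Qed.

(** Only connected [U] needs work. Expansion of a maximum independent set with
    one vertex removed gives [#|U| >= 3 alpha(U) - 1], so a failure of the bound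
    forces [alpha(U - K) = alpha(U)]. Then a maximum independent set of [U - K]
    is also maximum in [U], and it expands by the common step with [Z = K],
    which gives [#|U| >= 3 alpha(U)] after all. *)
Lemma deletion_bound_W2_on U : W2_on U -> deletion_bound U.
Proof.
have [n] := ubnP #|U|; elim: n U => // n IHn U Un gU K KU gK mK.
have IH V : #|V| < #|U| -> W2_on V -> deletion_bound V.
  by move=> VU; apply: IHn; apply: leq_trans VU _; rewrite -ltnS.
have [U0|[u uU]] := set_0Vmem U.
  by rewrite U0 set0D alpha0 cards0.
have [cU|] := boolP (connected_on U); last first.
  move=> /forallPn[Q]; rewrite negb_imply => /andP[sQ /norP[Q0 QU]].
  have sC := splitsC sQ; have /andP[QsU _] := sQ.
  have part P : splits U P -> #|P| < #|U| -> 2 * alpha P + alpha (P :\: K) <= #|P|.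
    move=> sP PU; have gP := W2_on_splits gU sP.
    have -> : P :\: K = P :\: (K :&: P) by rewrite setDIr setDv setU0.
    apply: IH => //; first exact: subsetIr.
      rewrite setDIr setDv setU0; apply: W2_on_splits gK _; exact: splitsD.
    have /splitsP[PsU hP] := sP.
    move=> X /splitsP[XP hX] X0; have /mK/(_ X0) : splits U X.
      apply/splitsP; split; first exact: subset_trans PsU.
      by move=> x y xX yU xy; apply: (hX x) => //; apply: (hP x); rewrite // (subsetP XP).
    by rewrite -!setI_eq0 setIA setIAC (setIidPl XP).
  have lQ : #|Q| < #|U| by apply: proper_card; rewrite properEneq QU.
  have cQ := cardsID Q U; rewrite (setIidPr QsU) in cQ.
  have lC : #|U :\: Q| < #|U|.
    by rewrite -cQ -[X in X < _]add0n ltn_add2r card_gt0.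
  have h1 := part Q sQ lQ; have h2 := part _ sC lC.
  have aU := alpha_splits sQ; have aK := alpha_splits (splitsD K sQ).
  have aK2 : alpha (U :\: K :\: (Q :\: K)) <= alpha (U :\: Q :\: K).
    apply: alphaS; apply/subsetP => x; rewrite !inE.
    by case: (x \in K); rewrite ?andbF.
  move: h1 h2 aU aK aK2 cQ; clear; lia.
have hexp := expansion_step IH gU cU.
(* The removed vertex [v] and a neighbour [w] of it that no other vertex of [S]
   dominates are missed by the expansion of [S :\ v]. *)
have lo : 3 * alpha U <= #|U| + 1.
  have [S [iS SU aS]] := alpha_witness U.
  have : 0 < #|S|.
    by rewrite aS -(cards1 u); apply: leq_alpha; rewrite ?independent1 // sub1set.
  move=> /card_gt0P[v vS]; pose A := S :\ v.
  have AS : A \subset S := subsetDl _ _.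
  have iA := independentS AS iS; have AU := subset_trans AS SU.
  have cS : #|S| = #|A|.+1 by rewrite (cardsD1 v) vS.
  have hA : 2 * #|A| <= #|nbr A :&: U| by apply: hexp => //; rewrite -aS cS.
  have vD : v \in U :\: cln A.
    rewrite inE mem_cln (subsetP SU) // andbT !inE eqxx /=.
    apply: contraTN vS => /(subsetP (nbrS AS)) vN.
    by rewrite (disjointFl (independent_disjoint iS)).
  have [w wD vw] := (proj2 gU) A v iA AU vD.
  have dA : [disjoint A & nbr A :&: U].
    by apply: disjointWr (independent_disjoint iA); apply: subsetIl.
  have dvw : [disjoint A :|: nbr A :&: U & [set v; w]].
    have sub : A :|: nbr A :&: U \subset cln A by rewrite setUS ?subsetIl.
    apply: disjointWl sub _.
    rewrite disjoint_sym disjoints_subset subUset !sub1set !in_setC.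
    by move: vD wD; rewrite !in_setD => /andP[-> _] /andP[-> _].
  have : #|A :|: nbr A :&: U :|: [set v; w]| <= #|U|.
    apply: subset_leq_card; rewrite !subUset AU subsetIr !sub1set.
    by move: vD wD; rewrite !in_setD => /andP[_ ->] /andP[_ ->].
  have -> := cards_disjU dvw; have -> := cards_disjU dA.
  have vNw : v != w by apply: contraTneq vw => ->; rewrite e_irr.
  by rewrite cards2 vNw -aS cS; move: hA; clear; lia.
rewrite leqNgt; apply/negP => lt.
have aK : alpha (U :\: K) = alpha U.
  have := alphaS (subsetDl U K); move: lo lt; clear; lia.
have [S [iS SK aS]] := alpha_witness (U :\: K).
have SU : S \subset U := subset_trans SK (subsetDl _ _).
have SM : U \subset cln S by apply: alpha_maximal => //; rewrite aS.
have dSN := independent_disjoint iS.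
have eU : cln S :&: U = U by apply/setIidPr.
have cU1 : #|S| + #|nbr S :&: U| = #|U|.
  rewrite -cards_disjU; last by apply: disjointWr dSN; apply: subsetIl.
  by apply: eq_card => x; rewrite -[in RHS]eU !inE; case: (boolP (x \in S)) => //= /(subsetP SU)->.
have : 2 * #|S| <= #|nbr S :&: U|.
  apply: (@expansion_from_proper_subsets U S K) => //; rewrite ?eU //.
  - move=> B pB; have [BS _] := andP pB; apply: hexp.
    + exact: independentS iS.
    + exact: subset_trans SU.
    + by rewrite -aK -aS proper_card.
  - apply/subsetP => x xK; have xU := subsetP KU x xK; rewrite inE xU andbT.
    have := subsetP SM x xU; rewrite mem_cln => /orP[/(subsetP SK)|//].
    by rewrite inE xK.
  - have sUU : splits U U by apply/splitsP.
    have U0 : U != set0 by apply/set0Pn; exists u.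
    by have := mK _ sUU U0; rewrite -setI_eq0 (setIidPr KU).
move: cU1 lt aK aS; clear; lia.
Qed.

(** The deletion bound for [K = U]. *)
Lemma double_alpha_leq U : W2_on U -> 2 * alpha U <= #|U|.
Proof.
move=> gU; have := @deletion_bound_W2_on U gU U (subxx _).
rewrite setDv alpha0 addn0; apply.
  split=> [X _|X v _]; last by rewrite subset0 => /eqP-> ; rewrite !inE andbF.
  by rewrite subset0 => /eqP-> _; rewrite alpha0 cards0.
move=> Q /andP[QU _] Q0; rewrite -setI_eq0.
by rewrite (setIidPl QU).
Qed.

Lemma expansion U A : W2_on U -> connected_on U -> independent e A -> A \subset U ->
  #|A| < alpha U -> 2 * #|A| <= #|nbr A :&: U|.
Proof.
by move=> gU cU; apply: expansion_step => // V _; apply: deletion_bound_W2_on.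
Qed.

(** * From W_2 to the induced-subgraph formulation *)

Lemma in_W2_pair A B : in_W 2 e -> independent e A -> independent e B ->
  [disjoint A & B] -> exists S1 S2, [/\ independent e S1 /\ #|S1| = alpha setT,
    independent e S2 /\ #|S2| = alpha setT, [disjoint S1 & S2], A \subset S1 & B \subset S2].
Proof.
move=> [_ W2] iA iB dAB.
have [i|i j|S [mS dS AS]] := W2 (fun i : 'I_2 => if i == ord0 then A else B).
- by case: ifP.
- by case: i => [[|[|[]]] ?] //; case: j => [[|[|[]]] ?] //= _; rewrite // disjoint_sym.
have mE i : independent e (S i) /\ #|S i| = alpha setT.
  by have /andP[-> /eqP->] := mS i; rewrite alphaT.
exists (S ord0), (S (lift ord0 ord0)); split=> //.
- exact: dS.
- exact: (AS ord0).
- exact: (AS (lift ord0 ord0)).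
Qed.

(** Extending [X] and a vertex [v] outside [N[X]] to disjoint maximum independent
    sets, the one containing [X] dominates [v], so [v] is not isolated after
    deleting [N[X]]. *)
Lemma W2_on_setT : in_W 2 e -> W2_on setT.
Proof.
move=> W2; split=> [X iX _ XM | X v iX _ vX].
  have [|S [_ [[iS <-] _ _ XS _]]] := in_W2_pair W2 iX independent0.
    by rewrite disjoint_sym disjoints_subset sub0set.
  congr #|pred_of_set _|; apply/eqP; rewrite eqEsubset XS; apply/subsetP => x xS.
  have := subsetP XM x (in_setT x); rewrite mem_cln => /orP[//|/(subsetP (nbrS XS))].
  by rewrite (disjointFr (independent_disjoint iS)).
have /setDP[_] := vX; rewrite mem_cln => /norP[vX1 vX2].
have [|S1 [S2 [[iS cS] _ dS XS vS]]] := in_W2_pair W2 iX (independent1 v).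
  by rewrite disjoint_sym disjoints1.
rewrite sub1set in vS.
have := subsetP (alpha_maximal iS (subsetT _) cS) v (in_setT v).
rewrite mem_cln (disjointFl dS vS) => /nbrP[w wS wv]; exists w; last by rewrite e_sym.
rewrite inE in_setT andbT mem_cln; apply/norP; split.
  by apply: contra vX2 => wX; apply/nbrP; exists w.
by apply/negP => /(subsetP (nbrS XS)); rewrite (disjointFr (independent_disjoint iS)).
Qed.

Lemma connected_on_setT : connected_graph e -> connected_on setT.
Proof.
move=> ce; apply/forallP => K; apply/implyP => /splitsP[_ hK].
have [->|[x xK]] := set_0Vmem K; first by rewrite eqxx.
apply/orP; right; apply/eqP/setP => y; rewrite in_setT.
have clK : closed e (mem K).
  by apply: (intro_closed (sym_connect_sym e_sym)) => // a b ab aK; apply: hK ab.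
by rewrite -(closed_connect clK (ce x y)).
Qed.

(** * Ratios of consecutive counts *)

(** Double counting of the pairs of an independent set of cardinality [k.+1] and
    one of its vertices. *)
Lemma num_indepS k : k.+1 * num_indep e k.+1 =
  \sum_(A in [set A | independent e A & #|A| == k]) #|~: cln A|.
Proof.
pose P k A := independent e A && (#|A| == k).
have -> : k.+1 * num_indep e k.+1 = \sum_(B | P k.+1 B) \sum_(v in B) 1.
  rewrite mulnC -sum_nat_const; apply: eq_big => [B|B]; rewrite inE // => /andP[_ /eqP<-].
  by rewrite sum1_card.
rewrite (exchange_big_dep predT) //=.
under [RHS]eq_bigr do rewrite -sum1_card.
rewrite [RHS](exchange_big_dep predT) //=; apply: eq_bigr => v _.
rewrite (reindex_onto (fun A => v |: A) (fun B => B :\ v)) /=; last first.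
  by move=> B /andP[_ vB]; rewrite setD1K.
apply: eq_bigl => A; rewrite /P in_setC mem_cln negb_or setU11 ?andbT in_set.
have [vA|vA] := boolP (v \in A); rewrite /= ?andbF.
  apply/negbTE; rewrite negb_and orbC; apply/orP; left.
  by apply/eqP => E; have := setD11 v (v |: A); rewrite E vA.
rewrite setU1K // eqxx andbT cardsU1 vA add1n eqSS [RHS]andbAC; congr (_ && _).
apply/idP/andP => [iv|[iA vN]].
  split; first by apply: independentS iv; apply: subsetUr.
  apply/negP => /(subsetP (nbrS (subsetUr [set v] A))).
  by rewrite (disjointFr (independent_disjoint iv)) // setU11.
by rewrite setUC independentU ?independent1 // disjoint_sym disjoints1.
Qed.

Lemma num_indepS_upper k : connected_graph e -> in_W 2 e -> k < alpha setT ->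
  k.+1 * num_indep e k.+1 + 3 * k * num_indep e k <= #|T| * num_indep e k.
Proof.
move=> ce W2 ka; have gT := W2_on_setT W2; have cT := connected_on_setT ce.
rewrite num_indepS [3 * k * _]mulnC [#|T| * _]mulnC -!sum_nat_const -big_split /=.
apply: leq_sum => A; rewrite inE => /andP[iA /eqP cA].
have := expansion gT cT iA (subsetT _); rewrite cA setIT => /(_ ka) le.
rewrite -(cardsC (cln A)) addnC leq_add2r.
rewrite cards_disjU ?independent_disjoint // cA.
by move: le; clear; lia.
Qed.

Lemma num_indepS_lower k : in_W 2 e -> k <= alpha setT ->
  2 * (alpha setT - k) * num_indep e k <= k.+1 * num_indep e k.+1.
Proof.
move=> W2 ka; rewrite num_indepS mulnC -sum_nat_const.
apply: leq_sum => A; rewrite inE => /andP[iA /eqP cA].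
have [gA ->] := W2_on_localize (W2_on_setT W2) iA (subsetT _).
by rewrite cA addKn -setTD; apply: double_alpha_leq.
Qed.

End Graph.

Local Open Scope ring_scope.

Theorem corollary6p1 (T : finType) (e : rel T)
    (e_sym : symmetric e) (e_irr : irreflexive e)
    (e_conn : connected_graph e) (e_W2 : in_W 2 e)
    (n_ge : (3 * indep_number e <= #|T|)%N)
    (quad_ge0 : forall k : int,
        1 <= k -> k <= (indep_number e)%:Z - 1 ->
        0 <= k ^+ 2 - (#|T|%:Z - 2 * (indep_number e)%:Z) * k
             + 2 * (indep_number e)%:Z + 2) :
  indep_poly_log_concave e.
Proof.
move=> k /andP[k_gt0 k_le]; rewrite /indep_poly !coef_poly.
set a := indep_number e in quad_ge0 k_le *; set n := #|T| in quad_ge0.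
have -> : (k - 1 < a.+1)%N by lia.
have -> : (k + 1 < a.+1)%N by lia.
have -> : (k < a.+1)%N by lia.
have quad : (n * k <= k * k + 2 * a * k + 2 * a + 2)%N.
  have := quad_ge0 k ltac:(lia) ltac:(lia); rewrite expr2.
  move: (a) (n); clear; lia.
case: k k_gt0 k_le quad => // k _ k_le quad; rewrite subn1 addn1 /=.
have := num_indepS_upper e_sym e_irr (k := k.+1) e_conn e_W2.
have := num_indepS_lower e_sym e_irr (k := k) e_W2.
rewrite alphaT -/a -/n => /(_ ltac:(lia)) ge /(_ ltac:(lia)) le.
move: (num_indep e k) (num_indep e k.+1) (num_indep e k.+2) ge le => p q r ge le.
rewrite -!PoszM expr2 -PoszM lez_nat.
(* The common factor comes from the two count bounds and is positive since
   [k < a]. *)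
suff : (2 * (a - k) * k.+2 * (p * r) <= 2 * (a - k) * k.+2 * (q * q))%N.
  by rewrite leq_pmul2l // muln_gt0; lia.
have h1 := leq_mul ge (leqnn (k.+2 * r)).
have h2 := leq_mul (leqnn (k.+1 * q)) le.
have h3 := leq_mul quad (leqnn (q * q)).
have ak : (a = (a - k) + k)%N by lia.
rewrite {1 2}ak in h3; move: (a - k)%N h1 h2 h3 => c; clear.
by move: n => n h1 h2 h3; lia.
Qed.
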